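(* Let $t$ be a positive integer, and let $\mathcal{G} = \{G_1,\ldots,G_t\}$ be a family of $(n,D,\lambda)$-graphs on the same vertex set $V(\mathcal{G})$. Let $\Delta \geq 2$ be an integer, and let $S \subseteq V(\mathcal{G})$. Then $\mathcal{G}[S]$ contains every $[t]$-colored tree $\mathcal{T}$ with at most $|S| - 10 (t\Delta)^{1/2} \frac{n \lambda}{D}$ vertices and maximum $r$-degree $\Delta_r(\mathcal{T}) \leq \Delta$ for each $r \in [t]$.
   Context: Graphs are finite and simple. A graph $G$ is an $(n,D,\lambda)$-graph if it is a $D$-regular graph on $n$ vertices and all but at most one of the eigenvalues of its adjacency matrix (counted with multiplicity) are bounded in absolute value by $\lambda$; here $D>0$, so that $n\lambda/D$ is defined. All graphs of the family have the same parameters $n,D,\lambda$. $[t]=\{1,\ldots,t\}$. For $S\subseteq V(\mathcal{G})$, $\mathcal{G}[S]=\{G_1[S],\ldots,G_t[S]\}$, where $G_i[S]$ is the subgraph of $G_i$ induced by $S$. A $[t]$-colored tree $\mathcal{T}$ is a tree $T$ with an arbitrary map $f:E(T)\to[t]$; the $r$-degree of a vertex $v$ is the number of neighbors $u$ of $v$ in $T$ with $f(uv)=r$, and $\Delta_r(\mathcal{T})$ is the maximum $r$-degree over all vertices. $\mathcal{G}[S]$ contains $\mathcal{T}$ if there is an injective map $\phi:V(T)\to S$ such that $\phi(u)\phi(v)\in E(G_{f(uv)})$ for every edge $uv\in E(T)$. *)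

(* Defs.v *)
From HB Require Import structures.
From mathcomp Require Import all_boot all_order all_algebra.
From mathcomp Require Import reals.
Set Implicit Arguments.
Unset Strict Implicit.
Unset Printing Implicit Defensive.
Import Order.TTheory GRing.Theory Num.Theory.

Record sgraph (V : finType) := SGraph {
  adj :> rel V;
  adj_sym : symmetric adj;
  adj_irrefl : irreflexive adj }.

Definition degree (V : finType) (G : sgraph V) (v : V) : nat :=
  #|[set u | G v u]|.

Definition adjacency_matrix (R : realType) (V : finType) (G : sgraph V) :
    'M[R]_#|V| :=
  \matrix_(i, j) ((G (enum_val i) (enum_val j))%:R)%R.

(* [s] lists the eigenvalues of [A] with (algebraic) multiplicity. For a real
   symmetric matrix such an [s] exists, and it is unique up to permutation. *)
Definition is_spectrum (R : realType) (n : nat) (A : 'M[R]_n) (s : seq R) :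
    Prop :=
  (char_poly A = \prod_(x <- s) ('X - x%:P))%R.

Definition ndlambda_graph (R : realType) (V : finType) (n D : nat) (lam : R)
    (G : sgraph V) : Prop :=
  [/\ #|V| = n, 0 < D, (forall v : V, degree G v = D)
    & exists2 s : seq R, is_spectrum (adjacency_matrix R G) s
                       & count (fun x => ~~ (`|x| <= lam)%R) s <= 1].

Definition connected_graph (V : finType) (G : sgraph V) : Prop :=
  0 < #|V| /\ forall x y : V, connect G x y.

(* [ucycle] counts a single edge as a cycle of size 2. *)
Definition acyclic_graph (V : finType) (G : sgraph V) : Prop :=
  forall c : seq V, ucycle G c -> size c <= 2.

Definition tree (V : finType) (G : sgraph V) : Prop :=
  connected_graph G /\ acyclic_graph G.

(* An edge colouring is a map [f] on unordered pairs, the edge uv being the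
   set [set u; v]; only the values of [f] on edges are ever used. *)
Definition rdegree (t : nat) (W : finType) (T : sgraph W)
    (f : {set W} -> 'I_t) (r : 'I_t) (v : W) : nat :=
  #|[set u | T v u & f [set u; v] == r]|.

Definition max_rdegree (t : nat) (W : finType) (T : sgraph W)
    (f : {set W} -> 'I_t) (r : 'I_t) : nat :=
  \max_(v : W) rdegree T f r v.

Definition contains_colored (t : nat) (V : finType) (G : 'I_t -> sgraph V)
    (S : {set V}) (W : finType) (T : sgraph W) (f : {set W} -> 'I_t) : Prop :=
  exists phi : W -> V,
    [/\ injective phi, (forall u : W, phi u \in S)
      & forall u v : W, T u v -> G (f [set u; v]) (phi u) (phi v)].

(* Main.v *)
Require Import Defs.
From HB Require Import structures.
From mathcomp Require Import all_boot all_order all_algebra.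
From mathcomp Require Import reals complex zify ring lra.
Import Order.TTheory GRing.Theory Num.Theory.

(** Write L = n lam / D and N_c(X) for the set of vertices that have a
    c-coloured neighbour in X.

    The eigenvalue hypothesis enters through one consequence of the expander
    mixing lemma ([ndlambda_mixing]): if no edge of G_c joins X to B, then
    |X| |B| <= L^2.  What makes the square root of t Delta possible is that
    this bound is used unevenly.  With K = L / sqrt (t Delta), a set of about
    K vertices has all but L^2 / K = sqrt (t Delta) L vertices in its
    c-neighbourhood, and t Delta K is again sqrt (t Delta) L.

    The tree is embedded one vertex at a time, in the manner of Friedman and
    Pippenger and of Haxell.  Give each pair (v, c) of a vertex and a colour a
    demand, the number of c-children that may still have to be attached at v,
    at most Delta.  A step of the embedding takes a free vertex y in N_c(v),
    makes it unavailable, and lowers the demand of (v, c) by one.  If the free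
    part of the neighbourhood of every set of at most 2m pairs is at least as
    large as the total demand of the set, with strict inequality from size m
    on, then some y keeps this invariant ([extend_demand]).  Take m = t k with
    k slightly above K.  Among any m pairs some colour occurs with k vertices,
    so the mixing bound gives the strict inequality for large sets as long as
    enough vertices are free.  The invariant holds at the start after deleting
    fewer than m vertices of S: the vertices of a maximal set of pairs that
    fails to expand ([expanding_core]).

    This embeds every tree with |W| + b + 3 t k (Delta + 1) <= |S|, where
    b = sqrt (t Delta) L ([joined_contains_tree]).  If K >= 1 one can take
    k <= 2 K, and Delta + 1 <= 3/2 Delta bounds the last term by
    9 sqrt (t Delta) L; this is where 10 = 1 + 9 comes from.  If K < 1 then a
    single vertex misses at most L^2 <= sqrt (t Delta) L others, and the
    greedy embedding succeeds ([greedy_contains_tree]). *)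

Set Implicit Arguments.
Unset Strict Implicit.
Unset Printing Implicit Defensive.

(** * Quadratic forms with one exceptional eigenvalue *)

Section Spectral.
Local Open Scope ring_scope.
Local Open Scope sesquilinear_scope.
Variable C : numClosedFieldType.
Local Notation "''[' u , v ]" := (dotmx u v).
Local Notation "''[' u ]" := (dotmx u u).

Lemma dotmx_unitary n (P : 'M[C]_n) (x y : 'rV[C]_n) :
  P \is unitarymx -> '[x *m P^t*, y *m P^t*] = '[x, y].
Proof.
move=> Pu; rewrite !dotmxE trmx_mul map_mxM trmxCK mulmxA -invmx_unitary //.
by rewrite mulmxKV // unitarymx_unit.
Qed.

Lemma char_poly_spectral n (A P : 'M[C]_n) (s : 'rV[C]_n) :
  P \in unitmx -> A = invmx P *m diag_mx s *m P ->
  char_poly A = \prod_(i < n) ('X - (s 0 i)%:P).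
Proof.
move=> Pu ->; pose Q := map_mx (@polyC C) P.
have Qu : map_mx (@polyC C) (invmx P) *m Q = 1%:M.
  by rewrite -map_mxM mulVmx // map_mx1.
have -> : char_poly (invmx P *m diag_mx s *m P) = char_poly (diag_mx s).
  rewrite /char_poly /char_poly_mx !map_mxM /= -/Q.
  rewrite [in LHS](_ : 'X%:M = map_mx (@polyC C) (invmx P) *m 'X%:M *m Q).
    rewrite -mulmxBl -mulmxBr !det_mulmx mulrAC -det_mulmx Qu det1 mul1r //.
  by rewrite scalar_mxC -mulmxA Qu mulmx1.
rewrite char_poly_trig ?diag_mx_is_trig //.
by apply: eq_bigr => i _; rewrite !mxE eqxx.
Qed.

(** All the eigenvectors of [A] but the [j]-th have eigenvalue at most [lam] in
    absolute value.  As [u] has an eigenvalue beyond [lam], it is a multiple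
    of the [j]-th one, so subtracting the component along [u] leaves a form
    bounded by [lam] through Cauchy-Schwarz.  Everything is multiplied by the
    square norm of [u] so that no division is needed. *)
Lemma mixing_one_eigenvalue n (A P : 'M[C]_n) (s : 'rV[C]_n) (d lam : C)
    (u x y : 'rV[C]_n) (j : 'I_n) :
  P \is unitarymx -> A = invmx P *m diag_mx s *m P ->
  u *m A = d *: u -> 0 <= lam -> ~~ (`|d| <= lam) ->
  (forall i, i != j -> `|s 0 i| <= lam) ->
  `|'[u] * '[x *m A, y] - d * ('[x, u] * '[u, y])| ^+ 2
    <= ('[u] * lam) ^+ 2 * ('[x] * '[y]).
Proof.
move=> Pu defA uA lam0 dlam slam.
pose h (z : 'rV[C]_n) := z *m P^t*.
have hA z : h (z *m A) = h z *m diag_mx s.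
  rewrite /h defA invmx_unitary // -!mulmxA.
  by rewrite (unitarymxP Pu) mulmx1.
have hdot z z' : '[h z, h z'] = '[z, z'] by exact: dotmx_unitary.
have dotE (z z' : 'rV[C]_n) : '[z, z'] = \sum_i z 0 i * (z' 0 i)^*.
  by rewrite dotmxE mxE; apply: eq_bigr => i _; rewrite !mxE.
(* A nonzero coordinate at i would make d the eigenvalue of index i. *)
have hu i : i != j -> h u 0 i = 0.
  move=> ij; have /rowP/(_ i) := hA u.
  rewrite uA /h -scalemxAl -/(h u) mul_mx_diag !mxE -/(h u) => /eqP.
  rewrite mulrC -subr_eq0 -mulrBr mulf_eq0 subr_eq0 => /orP[/eqP//|/eqP ds].
  by rewrite ds slam in dlam.
have dotu z : '[h z, h u] = h z 0 j * (h u 0 j)^*.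
  rewrite dotE (bigD1 j) //= big1 ?addr0 // => i ij.
  by rewrite hu // conjC0 mulr0.
have udot z : '[h u, h z] = h u 0 j * (h z 0 j)^*.
  rewrite dotE (bigD1 j) //= big1 ?addr0 // => i ij.
  by rewrite hu // mul0r.
have huj : d * '[u] = s 0 j * '[u].
  rewrite -(hdot u u) dotu mulrA mulrA; congr (_ * _).
  have /rowP/(_ j) := hA u; rewrite uA /h -scalemxAl -/(h u) mul_mx_diag !mxE.
  by rewrite [RHS]mulrC.
(* The coordinates of x *m A, with the component along u removed. *)
pose a := \row_i (if i == j then 0 else s 0 i * h x 0 i).
have aE i : a 0 i = if i == j then 0 else s 0 i * h x 0 i by rewrite mxE.
have sE i : (\matrix_(i, j) (h x i j * s 0 j)) 0 i = h x 0 i * s 0 i.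
  by rewrite mxE.
have -> : '[u] * '[x *m A, y] - d * ('[x, u] * '[u, y]) = '[u] * '[a, h y].
  have -> : '[x, u] * '[u, y] = '[u] * (h x 0 j * (h y 0 j)^*).
    rewrite -!(hdot _ u) -(hdot u y) dotu !udot; ring.
  rewrite mulrA huj -[s 0 j * '[u]]mulrC -mulrA -mulrBr; congr (_ * _).
  rewrite -(hdot (x *m A)) hA !dotE mul_mx_diag [X in X - _](bigD1 j) //= sE.
  rewrite [RHS](bigD1 j) //= aE eqxx mul0r add0r.
  rewrite (mulrC (h x 0 j)) mulrA addrAC subrr add0r.
  by apply: eq_bigr => i /negPf ij; rewrite sE aE ij [_ * s 0 i]mulrC.
rewrite normrM exprMn ger0_norm ?dnorm_ge0 //.
rewrite (exprMn _ _ lam) -[leRHS]mulrA ler_wpM2l ?exprn_ge0 ?dnorm_ge0 //.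
have cs : `|'[a, h y]| ^+ 2 <= '[a] * '[h y].
  exact: (CauchySchwarz (@dotmx C n) a (h y)).1.
apply: le_trans cs _.
rewrite hdot mulrA ler_wpM2r ?dnorm_ge0 // -(hdot x x) !dotE mulr_sumr.
apply: ler_sum => i _; rewrite aE; case: eqP => [_|/eqP ij].
  by rewrite mul0r mulr_ge0 ?mul_conjC_ge0 // exprn_ge0.
rewrite -!normCK normrM exprMn ler_wpM2r ?exprn_ge0 //.
by rewrite lerXn2r ?nnegrE // slam.
Qed.
End Spectral.

(** * The mixing bound for regular graphs *)

Section Mixing.
Local Open Scope ring_scope.
Local Open Scope sesquilinear_scope.

Lemma card_set_sum_enum_val (K : nzRingType) (V : finType) (X : {set V}) :
  \sum_(i < #|V|) (enum_val i \in X)%:R = #|X|%:R :> K.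
Proof.
rewrite -sum1_card natr_sum [RHS]big_mkcond.
rewrite [RHS](reindex (fun i : 'I_#|V| => enum_val i)); last first.
  exact/onW_bij/enum_val_bij.
by apply: eq_bigr => i _; case: (_ \in X).
Qed.

Lemma size_spectrum (R : realType) (V : finType) (G : sgraph V)
    (s : seq R) : is_spectrum (adjacency_matrix R G) s -> size s = #|V|.
Proof.
move=> /(congr1 (fun p : {poly R} => size p)).
by rewrite size_char_poly size_prod_XsubC => -[].
Qed.

(** As [0 < D], there are at least two eigenvalues, so one of them is bounded
    by [lam]. *)
Lemma ndlambda_ge0 (R : realType) (V : finType) (n D : nat) (lam : R)
    (G : sgraph V) : ndlambda_graph n D lam G -> (0 < n)%N -> 0 <= lam.
Proof.
case=> <- D0 degG [s /size_spectrum ss cs] /card_gt0P[v _].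
have : (0 < degree G v)%N by rewrite degG.
case/card_gt0P=> u; rewrite inE => Gvu.
have V2 : (1 < #|V|)%N.
  apply/card_gt1P; exists v, u; split=> //.
  by apply: contraTneq Gvu => ->; rewrite adj_irrefl.
have : has (fun x => `|x| <= lam) s.
  rewrite has_count -(ltn_add2r (count (predC (fun x => `|x| <= lam)) s)).
  by rewrite add0n count_predC ss (leq_ltn_trans cs).
by case/hasP=> x _; apply: le_trans.
Qed.

Definition indicator_row (K : nzRingType) (V : finType) (X : {set V}) :
    'rV[K]_#|V| :=
  \row_i (enum_val i \in X)%:R.

Lemma dotmx_indicator (K : numClosedFieldType) (V : finType) (X Y : {set V}) :
  dotmx (indicator_row K X) (indicator_row K Y) = #|X :&: Y|%:R.
Proof.
rewrite dotmxE mxE -(card_set_sum_enum_val K (X :&: Y)).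
by apply: eq_bigr => i _; rewrite !mxE rmorph_nat -natrM mulnb inE.
Qed.

(** Take the indicator rows of [X] and [Y] and the all-ones row, which is an
    eigenvector for [D] by regularity.  If [D] is beyond [lam] it is the one
    exceptional eigenvalue, the form of [X] and [Y] vanishes, and the mixing
    inequality reads (D |X| |Y|)^2 <= (n lam)^2 |X| |Y|.  If [D <= lam], the
    bound is at least n^2, which |X| |Y| never exceeds. *)
Theorem ndlambda_mixing (R : realType) (V : finType) (n D : nat) (lam : R)
    (G : sgraph V) (X Y : {set V}) :
  ndlambda_graph n D lam G -> (forall x y, x \in X -> y \in Y -> ~~ G x y) ->
  (#|X| * #|Y|)%:R <= (n%:R * lam / D%:R) ^+ 2.
Proof.
move=> hG noXY; have := hG => -[Vn D0 degG [s spec cs]].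
have [n0|n0] := posnP n.
  have -> : #|X| = 0%N by apply/eqP; rewrite -leqn0 -n0 -Vn max_card.
  by rewrite mul0n sqr_ge0.
have lam0 := ndlambda_ge0 hG n0.
have D0R : 0 < D%:R :> R by rewrite ltr0n.
have [Dlam|lamD] := leP D%:R lam.
  have nX : #|X|%:R <= n%:R :> R by rewrite ler_nat -Vn max_card.
  have nY : #|Y|%:R <= n%:R :> R by rewrite ler_nat -Vn max_card.
  have nL : n%:R <= n%:R * lam / D%:R :> R.
    by rewrite -mulrA ler_peMr // ler_pdivlMr // mul1r.
  by rewrite natrM expr2 ler_pM // (le_trans _ nL).
pose toC : {rmorphism R -> R[i]} := real_complex R.
have toC_norm x : `|toC x| = toC `|x|.
  by rewrite normc_def /= expr0n addr0 sqrtr_sqr.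
pose A := map_mx toC (adjacency_matrix R G).
have AE i j : A i j = (G (enum_val i) (enum_val j))%:R.
  by rewrite !mxE rmorph_nat.
have Anormal : A \is normalmx.
  apply/symmetric_normalmx.
    by apply/is_hermitianmxP/matrixP => i j; rewrite !mxE mul1r adj_sym.
  by apply/mxOverP => i j; rewrite AE realn.
have /orthomx_spectralP defA := Anormal.
set P := spectralmx A in defA; set sd := spectral_diag A in defA.
have Pu : P \is unitarymx by apply: spectral_unitarymx.
have charA : char_poly A = \prod_(z <- [seq toC x | x <- s]) ('X - z%:P).
  rewrite -map_char_poly spec rmorph_prod big_map; apply: eq_bigr => x _.
  by rewrite rmorphB /= map_polyX map_polyC.
have perm_sd : perm_eq [seq toC x | x <- s] [seq sd 0 i | i <- enum 'I_#|V|].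
  apply: prod_XsubC_eq; rewrite -charA big_map big_enum.
  exact: char_poly_spectral (unitarymx_unit Pu) defA.
pose ind := @indicator_row R[i] V.
pose u := ind setT.
have uA : u *m A = D%:R *: u.
  apply/rowP => j; rewrite !mxE inE mulr1 -(degG (enum_val j)) /degree.
  rewrite -card_set_sum_enum_val; apply: eq_bigr => i _.
  by rewrite AE mxE !inE mul1r adj_sym.
have Dlam : ~~ (`|D%:R : R[i]| <= toC lam).
  by rewrite normr_nat -(rmorph_nat toC) lecR -ltNge.
have u0 : u != 0.
  have i0 : 'I_#|V| by rewrite Vn; exists 0%N.
  by apply/eqP => /rowP/(_ i0); rewrite !mxE inE => /eqP; rewrite oner_eq0.
have [j sdj] : exists j, sd 0 j = D%:R.
  have : root (char_poly A) D%:R.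
    by rewrite -eigenvalue_root_char; apply/eigenvalueP; exists u.
  rewrite charA root_prod_XsubC (perm_mem perm_sd) => /mapP[j _ ->].
  by exists j.
have small i : i != j -> `|sd 0 i| <= toC lam.
  apply: contraNT => bad_i.
  have : (#|[pred i : 'I_#|V| | ~~ (`|sd 0 i| <= toC lam)%R]| <= 1)%N.
    rewrite cardE /enum_mem size_filter -enumT.
    rewrite -(count_map (fun i => sd 0 i) (fun z => ~~ (`|z| <= toC lam))).
    rewrite -(permP perm_sd) count_map (leq_trans _ cs) //.
    apply/eq_leq/eq_count => x /=.
    by rewrite toC_norm lecR.
  by move/card_le1_eqP => eq1; apply/eqP/eq1; rewrite inE ?sdj.
have lamC : 0 <= toC lam by rewrite -(rmorph0 toC) lecR.
have := mixing_one_eigenvalue (ind X) (ind Y) Pu defA uA lamC Dlam small.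
have XAY : dotmx (ind X *m A) (ind Y) = 0.
  rewrite dotmxE mxE big1 // => k _; rewrite !mxE mulr_suml big1 // => i _.
  rewrite !mxE !rmorph_nat.
  have [iX|_] := boolP (enum_val i \in X); last by rewrite !mul0r.
  have [kY|_] := boolP (enum_val k \in Y); last by rewrite mulr0.
  by rewrite (negPf (noXY _ _ iX kY)) mulr0 mul0r.
rewrite XAY !dotmx_indicator !setIT setTI !setIid cardsT Vn.
rewrite mulr0 sub0r normrN.
rewrite -!natrM normr_nat.
rewrite -!(rmorph_nat toC) -(rmorphM toC) -!(rmorphXn toC) -(rmorphM toC) lecR.
rewrite (natrM _ D).
set q := (#|X| * #|Y|)%:R => le_q.
have [q0|q0] := eqVneq q 0; first by rewrite q0 sqr_ge0.
have {}q0 : 0 < q by rewrite lt_def q0 ler0n.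
rewrite expr_div_n ler_pdivlMr ?exprn_gt0 // -(ler_pM2r q0).
by apply: le_trans le_q; rewrite exprMn; lra.
Qed.
End Mixing.

(** * Expansion with demands *)

Section Expansion.
Variables (P V : finType) (N : P -> {set V}).
Implicit Types (X Y Z : {set P}) (A : {set V}).

Definition nbhd X := \bigcup_(x in X) N x.

Lemma nbhdU X Y : nbhd (X :|: Y) = nbhd X :|: nbhd Y.
Proof. exact: bigcup_setU. Qed.

Lemma nbhdS X Y : X \subset Y -> nbhd X \subset nbhd Y.
Proof. by move=> /setUidPr <-; rewrite nbhdU subsetUl. Qed.

Lemma sum_setUI (dem : P -> nat) X Y :
  \sum_(z in X :|: Y) dem z + \sum_(z in X :&: Y) dem z
  = \sum_(z in X) dem z + \sum_(z in Y) dem z.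
Proof.
have -> : \sum_(z in X :|: Y) dem z
    = \sum_(z in X) dem z + \sum_(z in Y :\: X) dem z.
  rewrite (big_setID X) /= setUK; congr (_ + _).
  by rewrite setDUl setDv set0U.
rewrite [in RHS](big_setID (A := Y) X) /= setIC; lia.
Qed.

(** A choice of [y] is fatal only through a critical set: one that meets its
    demand exactly, has [y] in its neighbourhood, and does not contain [x].  By
    the strict inequality critical sets have fewer than [m] elements, and by
    submodularity they are closed under union, so there is a largest one, [K],
    that avoids [x].  The expansion of
    [x |: K] leaves a vertex of [N x] outside the neighbourhood of [K], hence
    outside that of every critical set avoiding [x]. *)
Lemma extend_demand m A (dem : P -> nat) (x : P) :
  (forall X, #|X| <= m.*2 -> \sum_(z in X) dem z <= #|nbhd X :&: A|) ->
  (forall X, m <= #|X| <= m.*2 -> \sum_(z in X) dem z < #|nbhd X :&: A|) ->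
  0 < dem x ->
  exists2 y, y \in N x :&: A &
    forall X, #|X| <= m.*2 ->
      \sum_(z in X) (dem z - (z == x)) <= #|nbhd X :&: (A :\ y)|.
Proof.
move=> expand slack dem_x.
have m0 : 0 < m.
  rewrite lt0n; apply/negP => /eqP m0.
  by have := slack set0; rewrite m0 /nbhd !big_set0 set0I !cards0 => /(_ isT).
pose critical X := (#|X| < m) && (#|nbhd X :&: A| == \sum_(z in X) dem z).
have crit0 : critical set0.
  by rewrite /critical cards0 m0 /nbhd !big_set0 set0I cards0.
(* The union of two critical sets still has at most 2m elements, which is why
   expansion is required up to 2m and not only m. *)
have critU X Y : critical X -> critical Y -> critical (X :|: Y).
  move=> /andP[Xm /eqP critX] /andP[Ym /eqP critY].
  have cU : #|X :|: Y| <= m.*2 by have := cardsUI X Y; lia.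
  have cI : #|X :&: Y| <= m.*2 by have := cardsUI X Y; lia.
  have capNI : #|nbhd (X :&: Y) :&: A| <= #|(nbhd X :&: A) :&: (nbhd Y :&: A)|.
    apply: subset_leq_card.
    by rewrite subsetI !setSI ?nbhdS ?subsetIl ?subsetIr.
  have NU : nbhd (X :|: Y) :&: A = (nbhd X :&: A) :|: (nbhd Y :&: A).
    by rewrite nbhdU setIUl.
  have tight : #|nbhd (X :|: Y) :&: A| <= \sum_(z in X :|: Y) dem z.
    have := sum_setUI dem X Y; have := expand _ cI.
    have := cardsUI (nbhd X :&: A) (nbhd Y :&: A); rewrite -NU; lia.
  rewrite /critical eqn_leq tight expand // !andbT ltnNge.
  apply/negP => mU; have := slack (X :|: Y); rewrite mU cU => /(_ isT); lia.
pose K := \bigcup_(X | critical X && (x \notin X)) X.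
have /andP[Km /eqP critK] : critical K.
  by apply: (big_ind critical) => // X /andP[].
have xK : x \notin K.
  by apply/bigcupP => -[X /andP[_ /negP]].
have [y yx yK] : exists2 y, y \in N x :&: A & y \notin nbhd K.
  have xKm : #|x |: K| <= m.*2 by rewrite cardsU1; lia.
  have := expand _ xKm; rewrite big_setU1 //= -critK => lt_xK.
  have /subsetPn[y] : ~~ (nbhd (x |: K) :&: A \subset nbhd K :&: A).
    by apply/negP => /subset_leq_card; lia.
  rewrite !inE nbhdU {1}/nbhd big_set1 => /andP[/setUP[yNx|yNK] yA].
    by rewrite yA andbT => yK; exists y => //; rewrite inE yNx.
  by rewrite yNK yA.
exists y => // X Xm; have := expand X Xm.
have cD : #|nbhd X :&: A| = (y \in nbhd X :&: A) + #|nbhd X :&: (A :\ y)|.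
  by rewrite setIDA; exact: cardsD1.
have le_sum : \sum_(z in X) (dem z - (z == x)) <= \sum_(z in X) dem z.
  by apply: leq_sum => z _; lia.
have [xX|xX] := boolP (x \in X).
  have eqD : \sum_(z in X :\ x) (dem z - (z == x)) = \sum_(z in X :\ x) dem z.
    by apply: eq_bigr => z /setD1P[/negPf-> _]; rewrite subn0.
  have split_x F : \sum_(z in X) F z = F x + \sum_(z in X :\ x) F z.
    exact: big_setD1.
  by rewrite cD !split_x eqD eqxx; lia.
have [yX|yX] := boolP (y \in nbhd X :&: A); last first.
  by rewrite cD (negPf yX); lia.
have [Xlt|] := boolP (critical X).
  case/negP: yK; move: yX; rewrite inE => /andP[yX _].
  by apply: subsetP yX; apply/nbhdS/(bigcup_sup X); rewrite Xlt.
rewrite negb_and -leqNgt => /orP[mX|nX] sX.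
  by have := slack X; rewrite mX Xm => /(_ isT); lia.
by move: nX; rewrite cD in sX *; lia.
Qed.

(** Delete the projection of a maximal set [Z] that fails to expand into what
    it leaves.  A set [X] over the rest that failed to expand could be added
    to [Z].  The inequality in the conclusion is strict, which leaves room for
    placing the root of the tree anywhere in [S0]. *)
Lemma expanding_core (pi : P -> V) m d (S : {set V}) :
  (forall Z, m <= #|Z| <= 3 * m -> d * #|Z| < #|nbhd Z :&: (S :\: pi @: Z)|) ->
  exists2 S0 : {set V}, S0 \subset S /\ #|S| < #|S0| + m
    & forall X, X != set0 -> #|X| <= m.*2 ->
        (forall x, x \in X -> pi x \in S0) -> d * #|X| < #|nbhd X :&: S0|.
Proof.
move=> joined.
pose sparse Z := (#|Z| <= 3 * m) && (#|nbhd Z :&: (S :\: pi @: Z)| <= d * #|Z|).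
have sparse0 : sparse set0 by rewrite /sparse /nbhd big_set0 set0I !cards0.
have [Z /andP[Z3m sparseZ] maxZ] :=
  @arg_maxnP _ set0 sparse (fun Z => #|Z|) sparse0.
have Zm : #|Z| < m.
  rewrite ltnNge; apply/negP => mZ.
  by have := joined Z; rewrite mZ Z3m => /(_ isT); lia.
exists (S :\: pi @: Z).
  split; first exact: subsetDl.
  have := cardsID (pi @: Z) S; have := subset_leq_card (subsetIr S (pi @: Z)).
  have := leq_imset_card pi Z; lia.
move=> X X0 Xm XS0; rewrite ltnNge; apply/negP => sparseX.
have dis : [disjoint Z & X].
  apply/pred0P => x /=; apply/negP => /andP[xZ /XS0].
  by rewrite inE imset_f.
have cU : #|Z :|: X| = #|Z| + #|X| by apply/eqP; rewrite (leq_card_setU Z X).2.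
have : sparse (Z :|: X).
  rewrite /sparse cU; apply/andP; split; first lia.
  have sub : nbhd (Z :|: X) :&: (S :\: pi @: (Z :|: X)) \subset
      (nbhd Z :&: (S :\: pi @: Z)) :|: (nbhd X :&: (S :\: pi @: Z)).
    by rewrite -setIUl nbhdU setIS // setDS // imsetS // subsetUl.
  have := subset_leq_card sub.
  have := (leq_card_setU (nbhd Z :&: (S :\: pi @: Z))
                         (nbhd X :&: (S :\: pi @: Z))).1.
  rewrite mulnDr; lia.
move/maxZ; rewrite /= cU => leX; move: X0; rewrite -card_gt0; lia.
Qed.
End Expansion.

(** * Embedding a tree vertex by vertex *)

Section Attach.
Variables (W : finType) (T : sgraph W).

Definition within (U : {set W}) : rel W :=
  [rel x y | [&& x \in U, y \in U & T x y]].

Definition spans (r : W) (U : {set W}) :=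
  forall w, w \in U -> connect (within U) r w.

Lemma within_sym U : symmetric (within U).
Proof. by move=> x y; rewrite /within /= adj_sym andbCA. Qed.

(** Two neighbours of [u] in [U] would be joined by a path inside [U], which
    [u] closes to a cycle. *)
Lemma tree_attach_unique r (U : {set W}) u w w' :
  tree T -> spans r U -> u \notin U -> w \in U -> w' \in U ->
  T u w -> T u w' -> w = w'.
Proof.
move=> [_ acyc] rU uU wU w'U Tuw Tuw'.
have /connectP[p0 p0P w'E] : connect (within U) w w'.
  apply: connect_trans (rU _ w'U).
  by rewrite (sym_connect_sym (@within_sym U)); apply: rU.
case/shortenP: p0P w'E => p pP p_uniq _ w'E.
have pU : {subset w :: p <= U}.
  have path_in x q : x \in U -> path (within U) x q -> {subset x :: q <= U}.
    elim: q x => [|z q IHq] x xU /= => [_ y|/andP[/and3P[_ zU _] /IHq qU] y].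
      by rewrite inE => /eqP->.
    by rewrite inE => /predU1P[->//|]; apply: qU.
  exact: path_in pP.
have : size (u :: w :: p) <= 2.
  apply: acyc; apply/andP; split; last first.
    rewrite cons_uniq p_uniq andbT; apply: contra uU; exact: pU.
  rewrite /= Tuw rcons_path -w'E adj_sym Tuw' andbT.
  by apply: sub_path pP => x y /and3P[].
by case: p w'E {pP p_uniq pU} => [->|].
Qed.

Lemma spans_attach r (U : {set W}) u w :
  spans r U -> w \in U -> T w u -> spans r (u |: U).
Proof.
move=> rU wU Twu.
have mono x : x \in U -> connect (within (u |: U)) r x.
  move=> /rU; apply: connect_sub => y z /and3P[yU zU Tyz].
  by apply: connect1; rewrite /within /= !inE yU zU Tyz !orbT.
move=> x /setU1P[->|/mono//].
apply: connect_trans (mono _ wU) (connect1 _).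
by rewrite /within /= !inE eqxx wU Twu orbT.
Qed.

Lemma tree_boundary_edge r (U : {set W}) :
  tree T -> r \in U -> U != setT ->
  exists w u, [/\ w \in U, u \notin U & T w u].
Proof.
move=> [[_ conn] _] rU; rewrite -subTset => /subsetPn[x _ xU].
have [/existsP[w /existsP[u /and3P[wU uU Twu]]]|none] :=
  boolP [exists w, exists u, [&& w \in U, u \notin U & T w u]].
  by exists w, u.
have /(closed_connect (a := U)) : forall y z, T y z -> (y \in U) = (z \in U).
  move=> y z Tyz; apply/idP/idP => [yU|zU]; apply: contraNT none => out.
    by apply/existsP; exists y; apply/existsP; exists z; rewrite yU out.
  by apply/existsP; exists z; apply/existsP; exists y; rewrite zU out adj_sym.
by move/(_ _ _ (conn r x)); rewrite rU (negPf xU).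
Qed.
End Attach.

(** The game behind the embedding: [Inv A dem] is any invariant of the set [A]
    of free vertices and of the demands that survives one step as long as more
    than [reserve] vertices are free. *)
Section Embedding.
Variables (t : nat) (V W : finType) (G : 'I_t -> sgraph V) (T : sgraph W).
Variables (f : {set W} -> 'I_t) (Delta reserve : nat) (S : {set V}).
Variable Inv : {set V} -> (V * 'I_t -> nat) -> Prop.
Hypothesis hT : tree T.
Hypothesis hdeg : forall r, max_rdegree T f r <= Delta.
Hypothesis hS : #|W| + reserve <= #|S|.
Hypothesis extension_step : forall A dem v c,
  Inv A dem -> reserve < #|A| -> 0 < dem (v, c) ->
  exists2 y, (y \in A) && G c v y
    & Inv (A :\ y) (fun z => dem z - (z == (v, c))).

Definition cnbrs (w : W) (c : 'I_t) (U : {set W}) : {set W} :=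
  [set u in U | T w u & f [set u; w] == c].

(** [pe_used] says that the demand left at a used vertex covers the neighbours
    still to be embedded; counting the parent among the embedded neighbours
    can only help, so the root needs no special treatment. *)
Record partial_embedding r (U : {set W}) (phi : W -> V) (A : {set V})
    (dem : V * 'I_t -> nat) : Prop := {
  pe_root : r \in U;
  pe_spans : spans T r U;
  pe_inj : {in U &, injective phi};
  pe_image : forall w, w \in U -> phi w \in S;
  pe_free : A = S :\: phi @: U;
  pe_edge : forall u v, u \in U -> v \in U -> T u v ->
    G (f [set u; v]) (phi u) (phi v);
  pe_used : forall w c, w \in U -> Delta <= dem (phi w, c) + #|cnbrs w c U|;
  pe_fresh : forall v c, v \in A -> Delta <= dem (v, c);
  pe_inv : Inv A dem }.

Lemma partial_embedding_extend r U phi A dem :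
  partial_embedding r U phi A dem -> U != setT ->
  exists u phi' A' dem',
    u \notin U /\ partial_embedding r (u |: U) phi' A' dem'.
Proof.
move=> [rU rspan phiI phiS AE edge used fresh inv] UT.
have [w [u [wU uU Twu]]] := tree_boundary_edge hT rU UT.
pose c := f [set u; w].
have card_cnbrs : #|cnbrs w c (u |: U)| = #|cnbrs w c U|.+1.
  have -> : cnbrs w c (u |: U) = u |: cnbrs w c U.
    apply/setP => x; rewrite !inE; case: eqP => [->|//].
    by rewrite Twu eqxx.
  by rewrite cardsU1 inE (negPf uU).
have demw : 0 < dem (phi w, c).
  have degw : rdegree T f c w <= Delta.
    exact: leq_trans (leq_bigmax w) (hdeg c).
  have : #|cnbrs w c (u |: U)| <= rdegree T f c w.
    by apply/subset_leq_card/subsetP => x; rewrite !inE => /andP[].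
  rewrite card_cnbrs; have := used w c wU; lia.
have phiW_A x : x \in U -> phi x \notin A.
  by move=> xU; rewrite AE inE imset_f.
have cardA : reserve < #|A|.
  have := cardsID (phi @: U) S; rewrite -AE.
  have := subset_leq_card (subsetIr S (phi @: U)); have := leq_imset_card phi U.
  have := cardsC U.
  have : 0 < #|~: U| by apply/card_gt0P; exists u; rewrite inE.
  lia.
have [y /andP[yA Gy] inv'] := extension_step inv cardA demw.
(* The new vertex keeps its own demand: it was free, so it is still whole. *)
exists u, (fun x => if x == u then y else phi x), (A :\ y),
  (fun z => dem z - (z == (phi w, c))); split=> //.
have yphi x : x \in U -> y != phi x.
  by move=> xU; apply: contraTneq yA => ->; apply: phiW_A.
have xu x : x \in U -> (x == u) = false.
  by move=> xU; apply: contraNF uU => /eqP <-.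
have Tu x : x \in U -> T u x -> x = w.
  move=> xU Tux; apply: (tree_attach_unique hT rspan uU) => //.
  by rewrite adj_sym.
split=> //.
- by rewrite inE rU orbT.
- exact: spans_attach Twu.
- move=> x x' /setU1P[->|xU] /setU1P[->|x'U]; rewrite ?eqxx ?xu //.
  + by move/eqP; rewrite (negPf (yphi _ x'U)).
  + by move/esym/eqP; rewrite (negPf (yphi _ xU)).
  + exact: phiI.
- move=> x /setU1P[->|xU]; rewrite ?eqxx ?xu //; last exact: phiS.
  by move: yA; rewrite AE inE => /andP[].
- rewrite AE setDDl setUC imsetU1 eqxx; congr (_ :\: (_ |: _)).
  by apply: eq_in_imset => x xU; rewrite xu.
- move=> x x' /setU1P[->|xU] /setU1P[->|x'U]; rewrite ?eqxx ?xu //.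
  + by rewrite adj_irrefl.
  + by move=> /(Tu _ x'U)->; rewrite adj_sym.
  + by rewrite adj_sym => /(Tu _ xU)->; rewrite setUC.
  + exact: edge.
- move=> x c' /setU1P[->|xU]; rewrite ?eqxx ?xu //.
    rewrite xpair_eqE (negPf (yphi _ wU)) /= subn0.
    by apply: leq_trans (leq_addr _ _); apply: fresh.
  have sub : cnbrs x c' U \subset cnbrs x c' (u |: U).
    by apply/subsetP => z; rewrite !inE => /andP[-> ->]; rewrite orbT.
  have := used x c' xU; have := subset_leq_card sub.
  case: eqP => [[/phiI xw ->]|_]; last by lia.
  rewrite {}xw // card_cnbrs; lia.
- move=> v c' /setD1P[_ vA]; rewrite xpair_eqE.
  have -> : (v == phi w) = false.
    by apply: contraTF vA => /eqP ->; apply: phiW_A.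
  by rewrite subn0; apply: fresh.
Qed.

Theorem embed_tree y0 dem0 :
  y0 \in S -> (forall v c, v \in S -> Delta <= dem0 (v, c)) ->
  Inv (S :\ y0) dem0 -> contains_colored G S T f.
Proof.
move=> y0S dem0S inv0; have /card_gt0P[r _] := hT.1.1.
have [U [phi [A [dem [pe UT]]]]] : exists U phi A dem,
    partial_embedding r U phi A dem /\ U = setT.
  suff ext k U phi A dem : partial_embedding r U phi A dem -> #|~: U| = k ->
      exists U phi A dem, partial_embedding r U phi A dem /\ U = setT.
    apply: (ext _ [set r] (fun=> y0) (S :\ y0) dem0); last by [].
    split=> //.
    - by rewrite inE.
    - by move=> w; rewrite inE => /eqP->; apply: connect0.
    - by move=> x y; rewrite !inE => /eqP-> /eqP->.
    - by rewrite imset_set1.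
    - by move=> u v; rewrite !inE => /eqP-> /eqP->; rewrite adj_irrefl.
    - by move=> w c _; apply: leq_trans (leq_addr _ _); apply: dem0S.
    - by move=> v c /setD1P[_ /dem0S].
  elim: k U phi A dem => [|k IHk] U phi A dem pe cU.
    exists U, phi, A, dem; split=> //.
    move/eqP: cU; rewrite cards_eq0 => /eqP U0.
    by apply: setC_inj; rewrite U0 setCT.
  have [//|u [phi' [A' [dem' [uU pe']]]]] := partial_embedding_extend pe.
    by apply/eqP => UT; rewrite UT setCT cards0 in cU.
  apply: IHk pe' _; have := cardsC U; have := cardsC (u |: U).
  by rewrite cardsU1 uU; lia.
exists phi; split=> [x y|x|x y Txy].
- by apply: (pe_inj pe); rewrite UT inE.
- by apply: (pe_image pe); rewrite UT inE.
- by apply: (pe_edge pe) => //; rewrite UT inE.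
Qed.
End Embedding.

(** * Families joining large sets in every colour *)

Section Joined.
Variables (t : nat) (V : finType) (G : 'I_t -> sgraph V).

Definition color_joined (k b : nat) := forall c (X B : {set V}),
  k <= #|X| -> (forall x y, x \in X -> y \in B -> ~~ G c x y) -> #|B| <= b.

Definition colored_nbrs (z : V * 'I_t) : {set V} := [set u | G z.2 z.1 u].

Lemma card_colored_pairs (X : {set V * 'I_t}) :
  #|X| = \sum_(c : 'I_t) #|[set v | (v, c) \in X]|.
Proof.
rewrite -sum1_card (partition_big (fun z => z.2) predT) //=.
apply: eq_bigr => c _; rewrite -sum1dep_card.
rewrite (reindex_onto (fun v => (v, c)) fst) /=.
  by apply: eq_bigl => v; rewrite !eqxx !andbT.
by move=> [v c'] /andP[_ /eqP /= ->].
Qed.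

(** By pigeonhole some colour occurs with at least [k] vertices in [X], and
    the neighbourhood in that colour alone misses at most [b] vertices. *)
Lemma joined_nbhd k b (X : {set V * 'I_t}) (A : {set V}) :
  0 < t -> color_joined k b -> t * k <= #|X| ->
  #|A| <= #|nbhd colored_nbrs X :&: A| + b.
Proof.
move=> t0 join tkX.
have [c kXc] : exists c, k <= #|[set v | (v, c) \in X]|.
  apply/existsP; apply: contraTT tkX; rewrite negb_exists => /forallP small.
  rewrite -ltnNge card_colored_pairs.
  apply: (@leq_trans (\sum_(c < t) k)); last by rewrite sum_nat_const card_ord.
  have lt_c c : #|[set v | (v, c) \in X]| < k by rewrite ltnNge.
  rewrite (bigD1 (Ordinal t0)) // [X in _ <= X](bigD1 (Ordinal t0)) //=.
  by rewrite -addSn leq_add //; apply: leq_sum => i _; apply: ltnW.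
rewrite -(cardsID (nbhd colored_nbrs X) A) setIC leq_add2l.
apply: (join c _ _ kXc) => x y; rewrite !inE => xX /andP[+ _].
by apply: contra => Gxy; apply/bigcupP; exists (x, c); rewrite ?inE.
Qed.
End Joined.

Section Combinatorial.
Variables (t : nat) (V W : finType) (G : 'I_t -> sgraph V) (T : sgraph W).
Variables (f : {set W} -> 'I_t) (Delta : nat) (S : {set V}).
Hypothesis hT : tree T.
Hypothesis hdeg : forall r, max_rdegree T f r <= Delta.

(** The reserve b + 2 m Delta, for m = t k, makes the neighbourhood of any m
    pairs exceed the demand of up to 2m pairs.  The rest of the hypothesis
    pays for the fewer than m vertices deleted to get an expanding core, and
    for sets of up to 3m pairs when that core is found. *)
Theorem joined_contains_tree k b :
  0 < t -> color_joined G k b ->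
  #|W| + b + 3 * (t * k) * Delta.+1 <= #|S| -> contains_colored G S T f.
Proof.
move=> t0 join hS; set m := t * k in hS.
have W0 : 0 < #|W| := hT.1.1.
pose N := colored_nbrs G; pose pi (z : V * 'I_t) := z.1.
have [|S0 [S0S cS0] core] := @expanding_core _ _ N pi m Delta S.
  move=> Z /andP[mZ Z3m]; have := joined_nbhd (S :\: pi @: Z) t0 join mZ.
  have := cardsID (pi @: Z) S; have := leq_imset_card pi Z.
  have := subset_leq_card (subsetIr S (pi @: Z)).
  have : #|Z| * Delta.+1 <= 3 * m * Delta.+1 by rewrite leq_mul2r Z3m orbT.
  rewrite mulnS -/N mulnC; lia.
(* Pairs over deleted vertices get no demand: they then impose no condition,
   and sets of pairs need not be restricted to the core. *)
pose dem0 (z : V * 'I_t) := if z.1 \in S0 then Delta else 0.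
pose Inv (A : {set V}) (dem : V * 'I_t -> nat) :=
  (forall X : {set V * 'I_t}, #|X| <= m.*2 ->
     \sum_(z in X) dem z <= #|nbhd N X :&: A|) /\
  (forall z, dem z <= Delta).
have /card_gt0P[y0 y0S] : 0 < #|S0| by lia.
suff [phi [phiI phiS phiE]] : contains_colored G S0 T f.
  by exists phi; split=> // u; apply: (subsetP S0S).
apply: (@embed_tree _ _ _ _ _ _ Delta (b + m.*2 * Delta) _ Inv _ _ _ _
  y0 dem0) => //.
- move: hS; rewrite mulnS -!mulnA -muln2 -mulnA; lia.
- move=> A dem v c [expand bound] cA demvc.
  have [//|X /andP[mX X2m]|//|y yNA expand'] :=
    @extend_demand _ _ N m A dem (v, c).
    apply: (@leq_ltn_trans (m.*2 * Delta)).
      apply: (@leq_trans (\sum_(z in X) Delta)); first exact: leq_sum.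
      by rewrite sum_nat_const leq_mul2r X2m orbT.
    have := joined_nbhd A t0 join mX; rewrite -/N; lia.
  exists y; first by move: yNA; rewrite !inE andbC.
  by split=> // z; apply: leq_trans (leq_subr _ _) (bound z).
- by move=> v c vS; rewrite /dem0 /= vS.
- split=> [X X2m|z]; last by rewrite /dem0; case: ifP.
  pose X0 := X :&: [set z | z.1 \in S0].
  have -> : \sum_(z in X) dem0 z = Delta * #|X0|.
    rewrite mulnC -sum_nat_const -big_mkcondr /=.
    by apply: eq_bigl => z; rewrite !inE.
  have [->|X0n] := eqVneq X0 set0; first by rewrite cards0 muln0.
  have X0m : #|X0| <= m.*2.
    by rewrite (leq_trans _ X2m) // subset_leq_card ?subsetIl.
  have X0S z : z \in X0 -> pi z \in S0 by rewrite !inE => /andP[].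
  have := core X0 X0n X0m X0S.
  have := subset_leq_card (setSI S0 (nbhdS N
    (subsetIl X [set z | z.1 \in S0]))).
  rewrite -/X0 (cardsD1 y0 (nbhd N X :&: S0)) -setIDA; move=> le_a lt_a.
  by have := leq_trans lt_a le_a; case: (y0 \in _) => // /ltnW.
Qed.

(** A single vertex misses at most [b] others, so any free neighbour will do
    and the invariant of the game is trivial. *)
Theorem greedy_contains_tree b :
  color_joined G 1 b -> #|W| + b <= #|S| -> contains_colored G S T f.
Proof.
move=> join hS; have W0 : 0 < #|W| := hT.1.1.
have /card_gt0P[y0 y0S] : 0 < #|S| by lia.
apply: (@embed_tree _ _ _ _ _ _ Delta b _ (fun _ _ => True) _ _ _ _ y0
  (fun=> Delta)) => // A dem v c _ cA _.
have [y yA] : exists y, (y \in A) && G c v y.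
  apply/existsP; apply: contraTT cA.
  rewrite negb_exists -leqNgt => /forallP none.
  apply: (join c [set v]); first by rewrite cards1.
  by move=> x y /set1P-> yA; have := none y; rewrite yA.
by exists y.
Qed.
End Combinatorial.

(** * Families of graphs with small second eigenvalue *)

Section Final.
Local Open Scope ring_scope.

Lemma ndlambda_color_joined (R : realType) (t : nat) (V : finType) (n D : nat)
    (lam : R) (G : 'I_t -> sgraph V) (k : nat) (b : R) :
  (forall i, ndlambda_graph n D lam (G i)) -> (0 < k)%N ->
  (n%:R * lam / D%:R) ^+ 2 <= k%:R * b -> color_joined G k (Num.truncn b).
Proof.
move=> hG k0 Lkb c X B kX noXB.
have kR : 0 < k%:R :> R by rewrite ltr0n.
have le_B : #|B|%:R <= b.
  rewrite -(ler_pM2l kR); apply: le_trans Lkb.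
  apply: le_trans (ndlambda_mixing (hG c) noXB).
  by rewrite natrM ler_wpM2r // ler_nat.
by rewrite truncn_ge_nat // (le_trans _ le_B).
Qed.
End Final.

Theorem theorem8 (R : realType) (t : nat) (ht : 0 < t)
    (V : finType) (n D : nat) (lam : R) (G : 'I_t -> sgraph V)
    (hG : forall i : 'I_t, ndlambda_graph n D lam (G i))
    (Delta : nat) (hDelta : 2 <= Delta) (S : {set V})
    (W : finType) (T : sgraph W) (hT : tree T) (f : {set W} -> 'I_t)
    (hcard : (#|W|%:R <= #|S|%:R
        - 10%:R * Num.sqrt ((t * Delta)%:R : R) * (n%:R * lam / D%:R))%R)
    (hdeg : forall r : 'I_t, max_rdegree T f r <= Delta) :
  contains_colored G S T f.
Proof.
Local Open Scope ring_scope.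
have W0 : (0 < #|W|)%N := hT.1.1.
have n0 : (0 < n)%N.
  rewrite lt0n; apply/eqP => n0; move: hcard W0.
  have -> : #|S| = 0%N.
    apply/eqP; rewrite -leqn0 -n0.
    by have [<- _ _ _] := hG (Ordinal ht); exact: max_card.
  by rewrite n0 !mul0r mulr0 subr0 ler_nat leqNgt => /negPf->.
have lam0 := ndlambda_ge0 (hG (Ordinal ht)) n0.
set q := Num.sqrt _ in hcard; set L := n%:R * lam / D%:R in hcard.
have L0 : 0 <= L by rewrite divr_ge0 ?mulr_ge0.
have tD0 : (0 < t * Delta)%N by rewrite muln_gt0 ht (leq_trans _ hDelta).
have q0 : 0 < q by rewrite sqrtr_gt0 ltr0n.
have qq : q ^+ 2 = (t * Delta)%:R by rewrite sqr_sqrtr.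
(* The two cases are K < 1 and 1 <= K, for K = L / sqrt (t Delta). *)
have [Lq|qL] := ltP L q.
  apply: (@greedy_contains_tree _ _ _ _ _ _ _ _ hT hdeg (Num.truncn (L ^+ 2))).
    by apply: ndlambda_color_joined => //; rewrite mul1r.
  have /andP[le_trunc _] := truncn_itv (sqr_ge0 L).
  rewrite -(ler_nat R) natrD.
  have LL : L ^+ 2 <= q * L by rewrite expr2 ler_wpM2r // ltW.
  have := mulr_ge0 (ltW q0) L0; lra.
pose K := L / q; pose k := (Num.truncn K).+1.
have LK : L = K * q by rewrite /K divfK // gt_eqF.
have K1 : 1 <= K by rewrite /K ler_pdivlMr // mul1r.
have K0 : 0 <= K by lra.
have /andP[kK Kk] := truncn_itv K0.
have k2K : k%:R <= 2 * K by rewrite /k -natr1; lra.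
have qL0 : 0 <= q * L by rewrite mulr_ge0 // ltW.
apply: (@joined_contains_tree _ _ _ _ _ _ _ _ hT hdeg
  k (Num.truncn (q * L))) => //.
  apply: ndlambda_color_joined => //; rewrite -/L {1}LK.
  have -> : (K * q) ^+ 2 = K * (q * L) by rewrite LK; ring.
  by rewrite ler_wpM2r // ltW.
have /andP[le_b _] := truncn_itv qL0.
have le_tk : (3 * (t * k) * Delta.+1)%:R <= 9 * (q * L).
  have D2 : 2 <= Delta%:R :> R by rewrite ler_nat.
  have -> : q * L = t%:R * Delta%:R * K.
    by rewrite LK mulrCA -expr2 qq natrM; ring.
  rewrite !natrM -natr1.
  have tK : t%:R * k%:R <= t%:R * (2 * K) :> R by rewrite ler_wpM2l.
  have D1 : 0 <= Delta%:R + 1 :> R by lra.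
  have := ler_wpM2r D1 tK.
  have tK0 : 0 <= t%:R * K by rewrite mulr_ge0.
  have := ler_wpM2l tK0 D2; lra.
rewrite -(ler_nat R) 2!natrD; lra.
Qed.
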